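(* Let $a<b$ be real numbers, $q\ge 1$, $n\ge 0$ integers, and let $(s_k)_{k=0}^{2n+1}$ be a sequence of Hermitian $q\times q$ matrices which is Hausdorff positive definite on $[a,b]$, i.e. the block Hankel matrices $H_{3,n}$ and $H_{4,n}$ are positive definite. Assume that $\widetilde H_{1,n}$ and (if $n\ge1$) $\widetilde H_{1,n-1}$ are invertible. Let $P_{r,j}$, $Q_{r,j}$ be the matrix polynomials defined in the context. Then $$P_{1,n+1}(a)\,Q_{2,n}^*(a)-ab\,Q_{1,n+1}(0)\,P_{2,n}^*(0)-P_{1,n+1}(0)\,Q_{2,n}^*(0)=0,$$ $$(b-a)\,Q_{4,n}(a)\,P_{3,n}^*(a)-b\,Q_{4,n}(0)\,P_{3,n}^*(0)-a\,P_{4,n}(0)\,Q_{3,n}^*(0)=0.$$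
   Context: All block entries are $q\times q$ complex matrices; $I$ and $0$ are identity and zero matrices of appropriate size. For a matrix function $F$ write $F^*(z):=(F(z))^*$. Moments: $s^{(1)}_j=s_j$, $s^{(2)}_j=-ab\,s_j+(a+b)s_{j+1}-s_{j+2}$, $s^{(3)}_j=b s_j-s_{j+1}$, $s^{(4)}_j=-a s_j+s_{j+1}$. For $r=1,2,3,4$: $H_{r,j}=(s^{(r)}_{k+\ell})_{k,\ell=0}^{j}$, $\widetilde H_{1,j}=(s_{k+\ell+1})_{k,\ell=0}^{j}$, and for $j\ge1$, $Y_{r,j}$ is the block column with entries $s^{(r)}_j,\dots,s^{(r)}_{2j-1}$. $T_j$ is the $(j+1)\times(j+1)$ block matrix with $I$ on the first block subdiagonal and $0$ elsewhere ($T_0=0$); $R_j(z)=(I-zT_j)^{-1}$; $v_j$ is the block column $(I,0,\dots,0)^{T}$ with $j+1$ blocks; $u_j$ is the block column with entries $-s_0,\dots,-s_j$. $u_{1,j}=T_ju_j$; $u_{3,j}=-(I-bT_j)u_j$; $u_{4,j}=(I-aT_j)u_j$; $\widehat u_{2,j}$ is the block column with entries $s_1-(a+b)s_0,\,-s^{(2)}_0,\dots,-s^{(2)}_{j-1}$ ($j+1$ blocks); $u_{2,j}=u_{2,j}(z)=\widehat u_{2,j}+z v_j s_0$ for $j\ge 1$. For $j\ge1$, $\Sigma_{r,j}$ is the block column consisting of $-H_{r,j-1}^{-1}Y_{r,j}$ followed by $I$ (the matrices $H_{r,j-1}$ needed are positive definite under the hypotheses). Matrix polynomials: $P_{r,0}(z)=I$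 and $P_{r,j}(z)=\Sigma_{r,j}^*R_j(z)v_j$ for $j\ge1$; $Q_{1,0}=0$, $Q_{1,j}(z)=-\Sigma_{1,j}^*R_j(z)u_{1,j}$; $Q_{2,0}(z)=(a+b)s_0-s_1-z s_0$, $Q_{2,j}(z)=-\Sigma_{2,j}^*R_j(z)u_{2,j}(z)$; $Q_{3,0}=s_0$, $Q_{3,j}(z)=\Sigma_{3,j}^*R_j(z)u_{3,j}$; $Q_{4,0}=-s_0$, $Q_{4,j}(z)=\Sigma_{4,j}^*R_j(z)u_{4,j}$ ($j\ge1$). *)

(* Defs.v *)
From mathcomp Require Export all_boot all_order all_algebra.
From mathcomp Require Export complex reals.

Set Implicit Arguments.
Unset Strict Implicit.
Unset Printing Implicit Defensive.

Export Order.TTheory GRing.Theory Num.Theory.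
Open Scope ring_scope.
Open Scope complex_scope.
Open Scope sesquilinear_scope.

Definition posdefmx (C : numClosedFieldType) (m : nat) (M : 'M[C]_m) : Prop :=
  M \is hermsymmx /\
  forall x : 'cV[C]_m, x != 0 -> 0 < (x^t* *m M *m x) 0 0.

(* A finite sequence s_0, ..., s_N of q x q matrices is represented by a
   function on nat, of which only the values up to N matter.  A matrix
   polynomial is represented by its evaluation function z |-> F(z). *)
Section Defs.

Variables (C : numClosedFieldType) (q : nat).

Implicit Types (s : nat -> 'M[C]_q) (a b z : C) (j k l : nat).

(* The derived moments s^(2), s^(3), s^(4); s^(1) is s itself.  The objects
   with subscript r below that depend only on the moments s^(r) (hankel, Ycol,
   SigmaS, P) are obtained by applying the definition to s^(r). *)
Definition mom2 a b s j : 'M[C]_q :=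
  - (a * b) *: s j + (a + b) *: s j.+1 - s j.+2.
Definition mom3 b s j : 'M[C]_q := b *: s j - s j.+1.
Definition mom4 a s j : 'M[C]_q := - a *: s j + s j.+1.

(* Block indices run from 0 to j in hankel s j; \tilde H_{1,j} is the hankel
   matrix of the shifted sequence. *)
Definition hankel s j := \mxblock_(k < j.+1, l < j.+1) (s (k + l)%N : 'M[C]_q).
Definition hankel_shift s j := hankel (fun k => s k.+1) j.

Definition Ycol s j := \mxcol_(k < j) (s (j + k)%N : 'M[C]_q).

Definition T j :=
  \mxblock_(k < j.+1, l < j.+1)
    ((if k == l.+1 :> nat then 1%:M else 0) : 'M[C]_q).
Definition Res j z : 'M[C]_(\sum_(k < j.+1) q) :=
  invmx (1%:M - z *: T j).
Definition v j :=
  \mxcol_(k < j.+1) ((if k == 0%N :> nat then 1%:M else 0) : 'M[C]_q).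

Definition u s j := \mxcol_(k < j.+1) (- s k : 'M[C]_q).
Definition u1 s j : 'M[C]_(\sum_(k < j.+1) q, q) :=
  T j *m u s j.
Definition u2hat a b s j :=
  \mxcol_(k < j.+1)
    (if k : nat is k'.+1 then - mom2 a b s k'
     else s 1%N - (a + b) *: s 0%N : 'M[C]_q).
Definition u2 a b s j z : 'M[C]_(\sum_(k < j.+1) q, q) :=
  u2hat a b s j + z *: (v j *m s 0%N).
Definition u3 b s j : 'M[C]_(\sum_(k < j.+1) q, q) :=
  - ((1%:M - b *: T j) *m u s j).
Definition u4 a s j : 'M[C]_(\sum_(k < j.+1) q, q) :=
  (1%:M - a *: T j) *m u s j.

(* SigmaS s j is Sigma_{j+1}: the blocks 0, ..., j of - H_j^-1 Y_{j+1}, followed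
   by the identity block at the last index ord_max. *)
Definition SigmaS s j :=
  \mxcol_(k < j.+2)
    (if unlift ord_max k is Some k'
     then submxcol (- (invmx (hankel s j) *m Ycol s j.+1)) k'
     else 1%:M : 'M[C]_q).

Definition P s j z : 'M[C]_q :=
  if j is j'.+1 then (SigmaS s j')^t* *m Res j'.+1 z *m v j'.+1 else 1%:M.

Definition Q1 s j z : 'M[C]_q :=
  if j is j'.+1 then - ((SigmaS s j')^t* *m Res j'.+1 z *m u1 s j'.+1) else 0.
Definition Q2 a b s j z : 'M[C]_q :=
  if j is j'.+1
  then - ((SigmaS (mom2 a b s) j')^t* *m Res j'.+1 z *m u2 a b s j'.+1 z)
  else (a + b) *: s 0%N - s 1%N - z *: s 0%N.
Definition Q3 b s j z : 'M[C]_q :=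
  if j is j'.+1 then (SigmaS (mom3 b s) j')^t* *m Res j'.+1 z *m u3 b s j'.+1
  else s 0%N.
Definition Q4 a s j z : 'M[C]_q :=
  if j is j'.+1 then (SigmaS (mom4 a s) j')^t* *m Res j'.+1 z *m u4 a s j'.+1
  else - s 0%N.

(* Hausdorff positive definiteness on [a, b] of (s_0, ..., s_{2n+1}). *)
Definition hausdorff_posdef a b s n : Prop :=
  posdefmx (hankel (mom3 b s) n) /\ posdefmx (hankel (mom4 a s) n).

End Defs.

(* Main.v *)
From HB Require Import structures.
Require Import Defs.
From mathcomp Require Import ring.

Set Implicit Arguments.
Unset Strict Implicit.
Unset Printing Implicit Defensive.

(** Let L be the functional t^k |-> s_k on scalar polynomials (moment_int), so
    that L g stands for the integral of g against a matrix measure, and put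
    f(t) = (b - t)(t - a), D_k^z(t) = (t^k - z^k) / (t - z) (ddiff).  Expanding
    Res j z shows that, with p_k the coefficients of P_r,
      Q_1(z) =   sum_k p_k L(D_k^z),
      Q_2(z) =   sum_k p_k L(f D_k^z - z^k (t - (a + b) + z)),
      Q_3(z) =   sum_k p_k L(z^k - (b - t) D_k^z),
      Q_4(z) = - sum_k p_k L(z^k + (t - a) D_k^z).
    Each identity thus reads sum_{k,l} p_k L(phi_{k,l}) r_l^* = 0 for explicit
    scalar polynomials phi_{k,l}, each of which splits into two summands: one is t^k
    times a polynomial of low degree depending only on l and vanishes by the
    orthogonality of the left factor, the other is t^l times a polynomial of low
    degree depending only on k and vanishes by that of the right factor.
    The Hankel matrices of s^(1) and s^(2) behind the orthogonality relations
    are invertible because 1 and f, multiplied by b - a, are combinations of b - t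
    and t - a with nonnegative (sum of squares) coefficients. *)

(** * Conjugate transposes and block columns *)

Lemma adjmxM (C : numClosedFieldType) (m n p : nat)
    (A : 'M[C]_(m, n)) (B : 'M[C]_(n, p)) :
  (A *m B)^t* = B^t* *m A^t*.
Proof. by rewrite trmx_mul map_mxM. Qed.

Lemma adjmxZ (C : numClosedFieldType) (m n : nat) (a : C) (A : 'M[C]_(m, n)) :
  (a *: A)^t* = a^* *: A^t*.
Proof. by rewrite linearZ map_mxZ. Qed.

Lemma adjmx_sum (C : numClosedFieldType) (m n : nat) (I : Type) (r : seq I)
    (Q : pred I) (F : I -> 'M[C]_(m, n)) :
  (\sum_(i <- r | Q i) F i)^t* = \sum_(i <- r | Q i) (F i)^t*.
Proof. by rewrite !raddf_sum. Qed.

Lemma adjmxK (C : numClosedFieldType) (m n : nat) (A : 'M[C]_(m, n)) :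
  A^t*^t* = A.
Proof. by apply/matrixP => i j; rewrite !mxE conjCK. Qed.

Lemma hermsymmxE (C : numClosedFieldType) (m : nat) (A : 'M[C]_m) :
  (A \is hermsymmx) = (A^t* == A).
Proof. by rewrite is_hermitianmxE expr0 scale1r eq_sym. Qed.

Lemma adj_mxcol (C : numClosedFieldType) (p n : nat) (p_ : 'I_p -> nat)
    (B : forall i, 'M[C]_(p_ i, n)) :
  (\mxcol_i B i)^t* = \mxrow_i (B i)^t*.
Proof. by apply/matrixP => i j; rewrite !mxE. Qed.

(** * The block shift and its resolvent *)

Lemma mulmx_T_mxcol (C : numClosedFieldType) (q j m : nat)
    (w : nat -> 'M[C]_(q, m)) :
  T C q j *m \mxcol_(k < j.+1) w k =
  \mxcol_(k < j.+1) (if k : nat is k'.+1 then w k' else 0).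
Proof.
rewrite mul_mxblock_mxrow; apply/eq_mxcolP => -[[|k] lt_k] /=.
  by rewrite big1 // => l _; rewrite mul0mx.
rewrite (bigD1 (Ordinal (ltnW lt_k))) //= eqxx mul1mx big1 ?addr0 // => l.
rewrite -val_eqE /= eqSS eq_sym => /negPf ->.
by rewrite mul0mx.
Qed.

Lemma mulmx_subzT_mxcol (C : numClosedFieldType) (q j m : nat) (z : C)
    (w : nat -> 'M[C]_(q, m)) :
  (1%:M - z *: T C q j) *m \mxcol_(k < j.+1) w k =
  \mxcol_(k < j.+1) (w k - z *: (if k : nat is k'.+1 then w k' else 0)).
Proof.
rewrite mulmxBl mul1mx -scalemxAl mulmx_T_mxcol mxcolB; congr (_ - _).
by apply/matrixP => i l; rewrite !mxE.
Qed.

(** The inner sums solve the recursion y_k = w_k + z y_{k-1}, y_0 = w_0, which is the linear system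
    read row by row. *)
Lemma mulmx_subzT_sum (C : numClosedFieldType) (q j m : nat) (z : C)
    (w : nat -> 'M[C]_(q, m)) :
  (1%:M - z *: T C q j) *m
    \mxcol_(k < j.+1) \sum_(i < k.+1) z ^+ (k - i) *: w i =
  \mxcol_(k < j.+1) w k.
Proof.
rewrite (mulmx_subzT_mxcol j z (fun k => \sum_(i < k.+1) z ^+ (k - i) *: w i)).
apply/eq_mxcolP => -[[|k] lt_k] /=.
  by rewrite big_ord_recr big_ord0 /= add0r expr0 scale1r scaler0 subr0.
rewrite big_ord_recr /= subnn expr0 scale1r addrAC scaler_sumr.
rewrite [X in X - _](eq_bigr (fun i : 'I_k.+1 => z *: (z ^+ (k - i) *: w i))).
  by rewrite subrr add0r.
by move=> i _; rewrite scalerA -exprS subSn // -ltnS.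
Qed.

(** Solving the system with the block rows of the identity as right-hand side yields a right
    inverse. The rows are indexed through [inord] to fit a function on nat. *)
Lemma subzT_unit (C : numClosedFieldType) (q j : nat) (z : C) :
  1%:M - z *: T C q j \in unitmx.
Proof.
set I1 : 'M[C]_(\sum_(k < j.+1) q) := 1%:M.
have := mulmx_subzT_sum j z (fun k => submxcol I1 (inord k)).
have -> : \mxcol_(k < j.+1) submxcol I1 (inord k) = I1.
  by rewrite -[RHS]submxcolK; apply/eq_mxcolP => k; rewrite inord_val.
by case/mulmx1_unit.
Qed.

Lemma Res_mxcol (C : numClosedFieldType) (q j m : nat) (z : C)
    (w : nat -> 'M[C]_(q, m)) :
  Res q j z *m \mxcol_(k < j.+1) w k =
  \mxcol_(k < j.+1) \sum_(i < k.+1) z ^+ (k - i) *: w i.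
Proof. by rewrite -(mulmx_subzT_sum j z w) mulKmx ?subzT_unit. Qed.

(** * The moment functional and divided differences of monomials *)

Definition moment_int (C : numClosedFieldType) (q : nat) (s : nat -> 'M[C]_q)
    (p : {poly C}) : 'M[C]_q :=
  \sum_(i < size p) p`_i *: s i.

Lemma moment_int_widen (C : numClosedFieldType) (q : nat) (s : nat -> 'M[C]_q)
    (p : {poly C}) (N : nat) :
  (size p <= N)%N -> moment_int s p = \sum_(i < N) p`_i *: s i.
Proof.
move=> le_pN; rewrite /moment_int.
rewrite (big_ord_widen N (fun i => p`_i *: s i) le_pN) big_mkcond /=.
apply: eq_bigr => i _; case: ltnP => // le_pi.
by rewrite nth_default ?scale0r.
Qed.

Lemma moment_int_is_linear (C : numClosedFieldType) (q : nat)
    (s : nat -> 'M[C]_q) : linear (moment_int s).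
Proof.
(* The three sums have different lengths, so all are padded to a common N. *)
move=> c p r; have [N [Np Nr Ns]] : exists N,
    [/\ (size p <= N)%N, (size r <= N)%N & (size (c *: p + r)%R <= N)%N].
  exists (size p + size r + size (c *: p + r)%R)%N.
  by split; rewrite ?leq_addl // -addnA ?leq_addr // addnCA leq_addr.
rewrite !(@moment_int_widen _ _ _ _ N) // scaler_sumr -big_split /=.
by apply: eq_bigr => i _; rewrite coefD coefZ scalerDl scalerA.
Qed.

HB.instance Definition _ (C : numClosedFieldType) (q : nat)
    (s : nat -> 'M[C]_q) :=
  GRing.isLinear.Build C {poly C} 'M[C]_q _ (moment_int s)
    (moment_int_is_linear s).

Lemma moment_intZ (C : numClosedFieldType) (q : nat) (s : nat -> 'M[C]_q)
    (c : C) (p : {poly C}) : moment_int s (c *: p) = c *: moment_int s p.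
Proof. exact: linearZ. Qed.

Lemma moment_int_sum (C : numClosedFieldType) (q : nat) (s : nat -> 'M[C]_q)
    (I : Type) (r : seq I) (Q : pred I) (F : I -> {poly C}) :
  moment_int s (\sum_(i <- r | Q i) F i) =
  \sum_(i <- r | Q i) moment_int s (F i).
Proof. exact: linear_sum. Qed.

Lemma moment_intXn (C : numClosedFieldType) (q : nat) (s : nat -> 'M[C]_q)
    (k : nat) : moment_int s 'X^k = s k.
Proof.
rewrite (@moment_int_widen _ _ _ _ k.+1) ?size_polyXn // big_ord_recr /=.
rewrite coefXn eqxx scale1r big1 ?add0r // => i _.
by rewrite coefXn (ltn_eqF (ltn_ord i)) scale0r.
Qed.

Lemma moment_int_adj (C : numClosedFieldType) (q N : nat)
    (s : nat -> 'M[C]_q) (p : {poly C}) :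
  (forall k, (k < N)%N -> s k \is hermsymmx) ->
  p \is a polyOver (@Num.Def.real_num_pred C) ->
  (size p <= N)%N -> (moment_int s p)^t* = moment_int s p.
Proof.
move=> hs /polyOverP p_real le_pN; rewrite adjmx_sum; apply: eq_bigr => i _.
rewrite adjmxZ (CrealP (p_real _)); congr (_ *: _).
by apply/eqP; rewrite -hermsymmxE hs // (leq_trans _ le_pN).
Qed.

(** The quotient is given by its explicit coefficients, which makes its degree and the realness of
    its coefficients directly visible. For k = 0 the sum is empty, so the truncated predecessor does
    no harm. *)
Definition ddiff (C : numClosedFieldType) (z : C) (k : nat) : {poly C} :=
  \sum_(i < k) z ^+ (k.-1 - i) *: 'X^i.

Lemma mul_ddiff (C : numClosedFieldType) (z : C) (k : nat) :
  ('X - z%:P) * ddiff z k = 'X^k - (z ^+ k)%:P.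
Proof.
rewrite polyC_exp -[RHS]opprB subrXX -mulNr opprB; congr (_ * _).
by apply: eq_bigr => i _; rewrite -mul_polyC polyC_exp.
Qed.

Lemma size_ddiff (C : numClosedFieldType) (z : C) (k : nat) :
  (size (ddiff z k) <= k)%N.
Proof.
apply: (leq_trans (size_sum _ _ _)); apply/bigmax_leqP => i _.
by apply: leq_trans (size_scale_leq _ _) _; rewrite size_polyXn.
Qed.

Lemma polyOver_ddiff (C : numClosedFieldType) (z : C) (k : nat) :
  z \is Num.real -> ddiff z k \is a polyOver (@Num.Def.real_num_pred C).
Proof.
move=> z_real; rewrite /ddiff; apply: rpred_sum => i _.
by apply: polyOverZ; rewrite ?rpredX ?polyOverX.
Qed.

(** * The polynomials P and Q as sums over the coefficients of P *)

(** Block i+1 carries the weight z^(k-1-i), the coefficient of t^i in D_k^z. The hypothesis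
    describes the shape shared by all columns u_r: a special first block, then negated moments of
    the weight h. *)
Lemma moment_int_ddiff (C : numClosedFieldType) (q : nat) (z : C)
    (s : nat -> 'M[C]_q) (h : {poly C}) (w : nat -> 'M[C]_q) (k : nat) :
  (forall i, w i.+1 = - moment_int s (h * 'X^i)) ->
  \sum_(i < k.+1) z ^+ (k - i) *: w i =
  z ^+ k *: w 0%N - moment_int s (h * ddiff z k).
Proof.
move=> hw; rewrite big_ord_recl /= subn0; congr (_ + _).
rewrite /ddiff mulr_sumr moment_int_sum -sumrN; apply: eq_bigr => i _.
rewrite /= /bump leq0n add1n hw scalerN -scalerAr moment_intZ.
by rewrite -subn1 -subnDA add1n.
Qed.

(* The adjoints of the coefficients of P s n: these multiply from the right. *)
Definition Pcoef (C : numClosedFieldType) (q : nat) (s : nat -> 'M[C]_q)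
    (n : nat) : 'I_n.+1 -> 'M[C]_q :=
  if n is n'.+1 then submxcol (SigmaS s n') else fun=> 1%:M.

(** Common source of the formulas below: the weight h is 0 for P, 1 for Q_1, (b - t)(t - a) for Q_2,
    b - t for Q_3 and t - a for Q_4. *)
Lemma Sigma_Res_mxcol (C : numClosedFieldType) (q j : nat) (z : C)
    (s t w : nat -> 'M[C]_q) (h : {poly C}) :
  (forall i, w i.+1 = - moment_int t (h * 'X^i)) ->
  (SigmaS s j)^t* *m Res q j.+1 z *m \mxcol_(k < j.+2) w k =
  \sum_(k < j.+2) (Pcoef s k)^t* *m
    (z ^+ k *: w 0%N - moment_int t (h * ddiff z k)).
Proof.
move=> hw; rewrite -mulmxA Res_mxcol -[SigmaS s j]submxcolK adj_mxcol.
rewrite mul_mxrow_mxcol; apply: eq_bigr => k _.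
by rewrite (moment_int_ddiff _ _ hw).
Qed.

Lemma P_sum (C : numClosedFieldType) (q : nat) (s : nat -> 'M[C]_q)
    (n : nat) (z : C) :
  P s n z = \sum_(k < n.+1) z ^+ k *: (Pcoef s k)^t*.
Proof.
case: n => [|j].
  by rewrite big_ord_recl big_ord0 addr0 expr0 scale1r trmx1 map_mx1.
rewrite /P /v.
rewrite (@Sigma_Res_mxcol _ _ _ _ _ s
  (fun k => if k == 0%N then 1%:M else 0) 0).
  apply: eq_bigr => k _.
  by rewrite mul0r raddf0 subr0 /= -scalemxAr mulmx1.
by move=> i; rewrite mul0r raddf0 oppr0.
Qed.

Lemma Q1_sum (C : numClosedFieldType) (q : nat) (s : nat -> 'M[C]_q)
    (n : nat) (z : C) :
  Q1 s n z = \sum_(k < n.+1) (Pcoef s k)^t* *m moment_int s (ddiff z k).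
Proof.
case: n => [|j].
  by rewrite big_ord_recl big_ord0 addr0 /ddiff big_ord0 raddf0 mulmx0.
rewrite /Q1 /u1 /u (mulmx_T_mxcol j.+1 (fun k => - s k)).
rewrite (@Sigma_Res_mxcol _ _ _ _ _ s
  (fun k => if k is k'.+1 then - s k' else 0) 1); last first.
  by move=> i; rewrite mul1r moment_intXn.
rewrite -sumrN; apply: eq_bigr => k _.
by rewrite scaler0 add0r mul1r mulmxN opprK.
Qed.

Lemma moment_int_mom2 (C : numClosedFieldType) (q : nat) (s : nat -> 'M[C]_q)
    (a b : C) (k : nat) :
  moment_int s ((b%:P - 'X) * ('X - a%:P) * 'X^k) = mom2 a b s k.
Proof.
have -> : (b%:P - 'X) * ('X - a%:P) * 'X^k =
    - (a * b) *: 'X^k + (a + b) *: 'X^(k.+1) - 'X^(k.+2) :> {poly C}.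
  by rewrite -!mul_polyC !exprS polyCN polyCM polyCD; ring.
by rewrite raddfB raddfD /= !moment_intZ !moment_intXn.
Qed.

Lemma moment_int_mom3 (C : numClosedFieldType) (q : nat) (s : nat -> 'M[C]_q)
    (b : C) (k : nat) :
  moment_int s ((b%:P - 'X) * 'X^k) = mom3 b s k.
Proof.
by rewrite mulrBl mul_polyC -exprS raddfB /= moment_intZ !moment_intXn.
Qed.

Lemma moment_int_mom4 (C : numClosedFieldType) (q : nat) (s : nat -> 'M[C]_q)
    (a : C) (k : nat) :
  moment_int s (('X - a%:P) * 'X^k) = mom4 a s k.
Proof.
rewrite mulrBl mul_polyC -exprS raddfB /= moment_intZ !moment_intXn.
by rewrite /mom4 scaleNr addrC.
Qed.

Lemma Q2_sum (C : numClosedFieldType) (q : nat) (s : nat -> 'M[C]_q)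
    (a b : C) (n : nat) (z : C) :
  Q2 a b s n z = \sum_(k < n.+1) (Pcoef (mom2 a b s) k)^t* *m
    moment_int s ((b%:P - 'X) * ('X - a%:P) * ddiff z k
                  - (z ^+ k)%:P * ('X - (a + b)%:P + z%:P)).
Proof.
(* The first block of [u2], including its dependence on z, is the moment of a polynomial of degree
   one. *)
have w0E : s 1%N - (a + b) *: s 0%N + z *: s 0%N =
    moment_int s ('X - (a + b)%:P + z%:P).
  have -> : 'X - (a + b)%:P + z%:P =
      'X^1 - (a + b) *: 'X^0 + z *: 'X^0 :> {poly C}.
    by rewrite expr0 expr1 !alg_polyC.
  by rewrite raddfD raddfB /= !moment_intZ !moment_intXn.
case: n => [|j].
  rewrite big_ord_recl big_ord0 addr0 /ddiff big_ord0 mulr0 sub0r expr0 mul1r.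
  by rewrite raddfN /= -w0E trmx1 map_mx1 mul1mx !opprD opprK [- _ + _]addrC.
rewrite /Q2 /u2.
have -> : u2hat a b s j.+1 + z *: (v C q j.+1 *m s 0%N) =
    \mxcol_(k < j.+2) (if k : nat is k'.+1 then - mom2 a b s k'
      else s 1%N - (a + b) *: s 0%N + z *: s 0%N).
  rewrite mxcol_mul.
  have -> (B : 'I_j.+2 -> 'M[C]_q) :
      z *: \mxcol_k B k = \mxcol_k (z *: B k).
    by apply/matrixP => i l; rewrite !mxE.
  rewrite -mxcolD; apply/eq_mxcolP => -[[|k] lt_k] /=; first by rewrite mul1mx.
  by rewrite mul0mx scaler0 addr0.
rewrite (@Sigma_Res_mxcol _ _ _ _ _ s
  (fun k => if k is k'.+1 then - mom2 a b s k'
      else s 1%N - (a + b) *: s 0%N + z *: s 0%N)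
  ((b%:P - 'X) * ('X - a%:P))); last first.
  by move=> i; rewrite moment_int_mom2.
rewrite -sumrN; apply: eq_bigr => k _.
rewrite w0E -mulmxN opprB mul_polyC; congr (_ *m _).
by rewrite raddfB /= moment_intZ.
Qed.

Lemma Q3_sum (C : numClosedFieldType) (q : nat) (s : nat -> 'M[C]_q)
    (b : C) (n : nat) (z : C) :
  Q3 b s n z = \sum_(k < n.+1) (Pcoef (mom3 b s) k)^t* *m
    moment_int s ((z ^+ k)%:P - (b%:P - 'X) * ddiff z k).
Proof.
have s0E : s 0%N = moment_int s 1 by rewrite -(expr0 'X) moment_intXn.
case: n => [|j].
  rewrite big_ord_recl big_ord0 addr0 /ddiff big_ord0 mulr0 subr0 expr0.
  by rewrite -s0E trmx1 map_mx1 mul1mx.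
rewrite /Q3 /u3 /u (mulmx_subzT_mxcol j.+1 b (fun k => - s k)) -mxcolN.
rewrite (@Sigma_Res_mxcol _ _ _ _ _ s
  (fun k => - (- s k - b *: (if k is k'.+1 then - s k' else 0)))
  (b%:P - 'X)); last first.
  by move=> i; rewrite moment_int_mom3 scalerN opprK addrC.
apply: eq_bigr => k _; congr (_ *m _).
by rewrite scaler0 subr0 opprK raddfB /= s0E -moment_intZ alg_polyC.
Qed.

Lemma Q4_sum (C : numClosedFieldType) (q : nat) (s : nat -> 'M[C]_q)
    (a : C) (n : nat) (z : C) :
  Q4 a s n z = - \sum_(k < n.+1) (Pcoef (mom4 a s) k)^t* *m
    moment_int s ((z ^+ k)%:P + ('X - a%:P) * ddiff z k).
Proof.
have s0E : s 0%N = moment_int s 1 by rewrite -(expr0 'X) moment_intXn.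
case: n => [|j].
  rewrite big_ord_recl big_ord0 addr0 /ddiff big_ord0 mulr0 addr0 expr0.
  by rewrite -s0E trmx1 map_mx1 mul1mx.
rewrite /Q4 /u4 /u (mulmx_subzT_mxcol j.+1 a (fun k => - s k)).
rewrite (@Sigma_Res_mxcol _ _ _ _ _ s
  (fun k => - s k - a *: (if k is k'.+1 then - s k' else 0))
  ('X - a%:P)); last first.
  move=> i; rewrite moment_int_mom4 /mom4 scalerN opprK opprD scaleNr opprK.
  by rewrite addrC.
rewrite -sumrN; apply: eq_bigr => k _; rewrite -mulmxN; congr (_ *m _).
by rewrite scaler0 subr0 scalerN raddfD /= opprD s0E -moment_intZ alg_polyC.
Qed.

(** * Orthogonality relations *)

(** This is block row l of H X = - Y with X = - H^-1 Y: the final identity block of Sigma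
    contributes s_{l+n}, which is entry l of Y. *)
Lemma Pcoef_right_orth (C : numClosedFieldType) (q n l : nat)
    (s : nat -> 'M[C]_q) :
  hankel s n.-1 \in unitmx -> (l < n)%N ->
  \sum_(k < n.+1) s (l + k)%N *m Pcoef s k = 0.
Proof.
case: n => // j /= unitH lt_l.
rewrite big_ord_recr /= mxcolK unlift_none mulmx1.
set X := - (invmx (hankel s j) *m Ycol s j.+1).
have HX : hankel s j *m X = - Ycol s j.+1 by rewrite mulmxN mulKVmx.
have := congr1 (fun M => submxcol M (Ordinal lt_l)) HX.
rewrite -[X]submxcolK mul_mxblock_mxrow mxcolK submxcolN mxcolK /= => HXl.
apply/eqP; rewrite addr_eq0 [(l + _)%N]addnC -HXl; apply/eqP/eq_bigr => k _.
rewrite mxcolK; congr (_ *m _).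
have -> : widen_ord (leqnSn j.+1) k = lift ord_max k.
  by apply/val_inj; rewrite [RHS]lift_max.
by rewrite liftK.
Qed.

(** Adjoint of the right relation. Since l < n and k <= n, only moments of index at most 2n - 1 have
    to be Hermitian. *)
Lemma Pcoef_left_orth (C : numClosedFieldType) (q n l : nat)
    (s : nat -> 'M[C]_q) :
  (forall k, (k < n.*2)%N -> s k \is hermsymmx) ->
  hankel s n.-1 \in unitmx -> (l < n)%N ->
  \sum_(k < n.+1) (Pcoef s k)^t* *m s (l + k)%N = 0.
Proof.
move=> hs unitH lt_l.
have := congr1 (fun M => M^t*) (Pcoef_right_orth unitH lt_l).
rewrite adjmx_sum trmx0 map_mx0 => orth; rewrite -[RHS]orth.
apply: eq_bigr => k _; rewrite adjmxM; congr (_ *m _); apply/esym/eqP.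
by rewrite -hermsymmxE hs // -addnn -addSn leq_add // -ltnS.
Qed.

Lemma moment_int_mul_coef (C : numClosedFieldType) (q : nat)
    (s r : nat -> 'M[C]_q) (h g : {poly C}) (n k : nat) :
  (forall k, moment_int s (h * 'X^k) = r k) -> (size g <= n)%N ->
  moment_int s (h * (g * 'X^k)) = \sum_(l < n) g`_l *: r (l + k)%N.
Proof.
move=> hr le_gn.
have {1}-> : g = \sum_(l < n) g`_l *: 'X^l.
  rewrite -poly_def; apply/polyP => i; rewrite coef_poly.
  by case: ltnP => // le_ni; rewrite nth_default // (leq_trans le_gn).
rewrite mulr_suml mulr_sumr moment_int_sum; apply: eq_bigr => l _.
by rewrite -scalerAl -scalerAr moment_intZ -exprD hr.
Qed.

(** Expanding g in monomials t^l with l < n reduces to the moment relations for h. For n = 0 the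
    expansion is empty, hence the guard on invertibility. *)
Lemma moment_int_right_orth (C : numClosedFieldType) (q n : nat)
    (s r : nat -> 'M[C]_q) (h g : {poly C}) :
  (forall k, moment_int s (h * 'X^k) = r k) ->
  ((0 < n)%N -> hankel r n.-1 \in unitmx) -> (size g <= n)%N ->
  \sum_(k < n.+1) moment_int s (h * (g * 'X^k)) *m Pcoef r k = 0.
Proof.
move=> hr unitH le_gn.
under eq_bigr => k _ do rewrite (moment_int_mul_coef _ hr le_gn) mulmx_suml.
rewrite exchange_big big1 //= => l _.
under eq_bigr => k _ do rewrite -scalemxAl.
rewrite -scaler_sumr Pcoef_right_orth ?scaler0 ?unitH //.
by apply: leq_ltn_trans (ltn_ord l).
Qed.

Lemma moment_int_left_orth (C : numClosedFieldType) (q n : nat)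
    (s r : nat -> 'M[C]_q) (h g : {poly C}) :
  (forall k, moment_int s (h * 'X^k) = r k) ->
  (forall k, (k < n.*2)%N -> r k \is hermsymmx) ->
  ((0 < n)%N -> hankel r n.-1 \in unitmx) -> (size g <= n)%N ->
  \sum_(k < n.+1) (Pcoef r k)^t* *m moment_int s (h * (g * 'X^k)) = 0.
Proof.
move=> hr herm unitH le_gn.
under eq_bigr => k _ do rewrite (moment_int_mul_coef _ hr le_gn) mulmx_sumr.
rewrite exchange_big big1 //= => l _.
under eq_bigr => k _ do rewrite -scalemxAr.
rewrite -scaler_sumr Pcoef_left_orth ?scaler0 ?unitH //.
by apply: leq_ltn_trans (ltn_ord l).
Qed.

(** * Positivity and invertibility of the Hankel matrices *)

(** The Hankel form x^* H x with N blocks. Vectors are functions on nat, so that shifting and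
    truncating them needs no change of block type. *)
Definition qform (C : numClosedFieldType) (q : nat) (s : nat -> 'M[C]_q)
    (N : nat) (x : nat -> 'cV[C]_q) : C :=
  (\sum_(k < N) (x k)^t* *m \sum_(l < N) s (k + l)%N *m x l) 0 0.

Definition posdef_seq (C : numClosedFieldType) (q : nat) (s : nat -> 'M[C]_q)
    (N : nat) : Prop :=
  forall x, 0 <= qform s N x /\
    (qform s N x = 0 -> forall k, (k < N)%N -> x k = 0).

Lemma hankel_qform (C : numClosedFieldType) (q j : nat) (s : nat -> 'M[C]_q)
    (x : nat -> 'cV[C]_q) :
  ((\mxcol_(k < j.+1) x k)^t* *m hankel s j *m \mxcol_(k < j.+1) x k) 0 0 =
  qform s j.+1 x.
Proof. by rewrite -mulmxA mul_mxblock_mxrow adj_mxcol mul_mxrow_mxcol. Qed.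

Lemma posdefmx_posdef_seq (C : numClosedFieldType) (q j : nat)
    (s : nat -> 'M[C]_q) :
  posdefmx (hankel s j) -> posdef_seq s j.+1.
Proof.
case=> _ pos x; rewrite -hankel_qform.
have [x0 | xn0] := eqVneq (\mxcol_(k < j.+1) x k) 0.
  rewrite x0 mulmx0 mxE; split=> // _ k lt_k.
  rewrite -[LHS](mxcolK (fun i : 'I_j.+1 => x i) (Ordinal lt_k)).
  by rewrite x0 submxcol0.
have q_gt0 := pos _ xn0; split; first exact: ltW.
by move=> q0; rewrite q0 ltxx in q_gt0.
Qed.

(** A kernel vector makes the form vanish, hence is zero. The transposes adapt this to [row_free],
    which speaks of row vectors. *)
Lemma posdef_seq_unit (C : numClosedFieldType) (q j : nat)
    (s : nat -> 'M[C]_q) :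
  posdef_seq s j.+1 -> hankel s j \in unitmx.
Proof.
move=> pos; rewrite -unitmx_tr -row_free_unit; apply: inj_row_free => v Hv.
have {}Hv : hankel s j *m v^T = 0.
  by rewrite -[hankel s j]trmxK -trmx_mul Hv trmx0.
pose x k := submxcol v^T (inord k : 'I_j.+1).
have vE : v^T = \mxcol_(k < j.+1) x k.
  by rewrite -[LHS]submxcolK; apply/eq_mxcolP => k; rewrite /x inord_val.
have [_ x0] := pos x; apply: trmx_inj; rewrite vE trmx0 -[RHS]mxcol0.
apply/eq_mxcolP => k; apply: x0 => //.
by rewrite -hankel_qform -vE -mulmxA Hv mulmx0 mxE.
Qed.

(** Summation by parts: the factor t - c moves from the coefficients x to the sequence A. *)
Lemma sum_shift_sub (C : numClosedFieldType) (m p r : nat)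
    (A : nat -> 'M[C]_(m, p)) (x : nat -> 'M[C]_(p, r)) (c : C) (N : nat) :
  \sum_(k < N.+1) A k *m ((if k : nat is k'.+1 then x k' else 0)
                          - c *: (if (k < N)%N then x k else 0)) =
  \sum_(k < N) (A k.+1 - c *: A k) *m x k.
Proof.
under eq_bigr => k _ do rewrite mulmxBr.
rewrite sumrB big_ord_recl mulmx0 add0r [in X in _ - X]big_ord_recr /= ltnn.
rewrite scaler0 mulmx0 addr0 -sumrB; apply: eq_bigr => k _.
by rewrite ltn_ord mulmxBl -scalemxAl -scalemxAr.
Qed.

(* The coefficients of (t - c) x(t) when x has degree less than N. *)
Definition shift_sub (C : numClosedFieldType) (q : nat) (c : C) (N : nat)
    (x : nat -> 'cV[C]_q) (k : nat) : 'cV[C]_q :=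
  (if k is k'.+1 then x k' else 0) - c *: (if (k < N)%N then x k else 0).

(** Replacing x(t) by (t - c) x(t) multiplies the weight by (t - c)^2 = t^2 - 2 c t + c^2, because c
    is real. *)
Lemma qform_shift_sub (C : numClosedFieldType) (q : nat)
    (s : nat -> 'M[C]_q) (c : C) (N : nat) (x : nat -> 'cV[C]_q) :
  c \is Num.real ->
  qform s N.+1 (shift_sub c N x) =
  qform (fun k => s k.+2 - (c *+ 2) *: s k.+1 + c ^+ 2 *: s k) N x.
Proof.
move=> c_real; rewrite /qform; congr (fun_of_matrix _ 0 0).
under eq_bigr => k _ do rewrite (sum_shift_sub (fun l => s (k + l)%N)).
(* Summation by parts is done in l; passing to adjoints puts the k-dependent vector on the right, so
   that it applies in k as well. *)
rewrite -[LHS]adjmxK -[RHS]adjmxK; congr (_^t*); rewrite !adjmx_sum.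
under eq_bigr => k _ do rewrite adjmxM adjmxK.
rewrite (sum_shift_sub (fun k : nat =>
  (\sum_(l < N) (s (k + l.+1)%N - c *: s (k + l)%N) *m x l)^t*)).
apply: eq_bigr => k _; rewrite adjmxM adjmxK; congr (_ *m _).
rewrite -[in c *: _](CrealP c_real) -adjmxZ -map_mxB -linearB /= scaler_sumr.
rewrite -sumrB; congr (_^t*); apply: eq_bigr => l _.
rewrite scalemxAl -mulmxBl !(addnS, addSn); congr (_ *m _).
by apply/matrixP => i i'; rewrite !mxE (CrealP c_real); ring.
Qed.

Lemma qform_lin (C : numClosedFieldType) (q : nat) (s r t : nat -> 'M[C]_q)
    (c : C) (N : nat) (x : nat -> 'cV[C]_q) :
  (forall k, c *: s k = r k + t k) ->
  c * qform s N x = qform r N x + qform t N x.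
Proof.
move=> lin.
pose F u : 'M_1 := \sum_(k < N) (x k)^t* *m \sum_(l < N) u (k + l)%N *m x l.
have FE : c *: F s = F r + F t.
  rewrite /F scaler_sumr -big_split; apply: eq_bigr => k _ /=.
  rewrite -mulmxDr scalemxAr scaler_sumr -big_split; congr (_ *m _).
  by apply: eq_bigr => l _ /=; rewrite scalemxAl lin mulmxDl.
by have := congr1 (fun M : 'M_1 => M 0 0) FE; rewrite mxE [RHS]mxE.
Qed.

Lemma posdef_seq_pred (C : numClosedFieldType) (q N : nat)
    (s : nat -> 'M[C]_q) :
  posdef_seq s N.+1 -> posdef_seq s N.
Proof.
(* Padding x with a zero block leaves the form unchanged. *)
move=> pos x; pose y k := if (k < N)%N then x k else 0.
have -> : qform s N x = qform s N.+1 y.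
  have yN : y N = 0 by rewrite /y ltnn.
  have yE (k : 'I_N) : y k = x k by rewrite /y ltn_ord.
  rewrite /qform big_ord_recr /= yN trmx0 map_mx0 mul0mx addr0.
  congr (fun_of_matrix _ 0 0); apply: eq_bigr => k _.
  rewrite yE big_ord_recr /= yN mulmx0 addr0; congr (_ *m _).
  by apply: eq_bigr => l _; rewrite yE.
have [y_ge0 y0] := pos y; split=> // /y0 {}y0 k lt_k.
by have := y0 k (ltnW lt_k); rewrite /y lt_k.
Qed.

(** Uses b - a = (b - t) + (t - a); if the sum of the two nonnegative forms is zero, each of them
    is. *)
Lemma posdef_seq_mom1 (C : numClosedFieldType) (q N : nat)
    (s : nat -> 'M[C]_q) (a b : C) :
  a < b -> posdef_seq (mom3 b s) N -> posdef_seq (mom4 a s) N ->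
  posdef_seq s N.
Proof.
move=> lt_ab pos3 pos4 x; have ba_gt0 : 0 < b - a by rewrite subr_gt0.
have qE : (b - a) * qform s N x = qform (mom3 b s) N x + qform (mom4 a s) N x.
  apply: qform_lin => k; apply/matrixP => i j.
  by rewrite /mom3 /mom4 !mxE; ring.
have [[ge3 x0] [ge4 _]] := (pos3 x, pos4 x).
split; first by rewrite -(pmulr_rge0 _ ba_gt0) qE addr_ge0.
move=> q0; apply: x0; apply/eqP; move/eqP: qE.
by rewrite q0 mulr0 eq_sym paddr_eq0 // => /andP[].
Qed.

(* Uses (b - a) (b - t) (t - a) = (t - a)^2 (b - t) + (t - b)^2 (t - a). *)
Lemma posdef_seq_mom2 (C : numClosedFieldType) (q N : nat)
    (s : nat -> 'M[C]_q) (a b : C) :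
  a \is Num.real -> b \is Num.real -> a < b ->
  posdef_seq (mom3 b s) N.+1 -> posdef_seq (mom4 a s) N.+1 ->
  posdef_seq (mom2 a b s) N.
Proof.
move=> a_real b_real lt_ab pos3 pos4 x.
have ba_gt0 : 0 < b - a by rewrite subr_gt0.
have qE : (b - a) * qform (mom2 a b s) N x =
    qform (mom3 b s) N.+1 (shift_sub a N x) +
    qform (mom4 a s) N.+1 (shift_sub b N x).
  rewrite !qform_shift_sub //; apply: qform_lin => k; apply/matrixP => i j.
  by rewrite /mom2 /mom3 /mom4 !mxE; ring.
have [[ge3 x0] [ge4 y0]] := (pos3 (shift_sub a N x), pos4 (shift_sub b N x)).
split; first by rewrite -(pmulr_rge0 _ ba_gt0) qE addr_ge0.
move=> q0 k lt_k; move/eqP: qE.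
rewrite q0 mulr0 eq_sym paddr_eq0 // => /andP[/eqP/x0 {}x0 /eqP/y0 {}y0].
(* Both (t - a) x and (t - b) x vanish, and their difference is (b - a) x. *)
have := congr2 (fun u w => u - w) (x0 k (ltnW lt_k)) (y0 k (ltnW lt_k)).
rewrite /shift_sub lt_k subr0 opprB addrC addrA addrNK -scalerBl.
by move/eqP; rewrite scaler_eq0 gt_eqF // => /eqP.
Qed.

(** * Pairings of two coefficient families through a polynomial kernel *)

(** Both quotients are monic of degree k - 1 when k > 0, so the top terms cancel. The first identity
    relies on this drop, its left factor having degree n + 1 and its right factor only n. *)
Lemma size_ddiffB (C : numClosedFieldType) (z w : C) (k : nat) :
  (size (ddiff z k - ddiff w k)%R <= k.-1)%N.
Proof.
case: k => [|k]; first by rewrite /ddiff !big_ord0 subr0 size_poly0.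
rewrite /ddiff !big_ord_recr /= subnn !expr0 opprD addrACA subrr addr0 -sumrB.
apply: (leq_trans (size_sum _ _ _)); apply/bigmax_leqP => i _.
rewrite -scalerBl; apply: leq_trans (size_scale_leq _ _) _.
by rewrite size_polyXn.
Qed.

(** Each product in the two identities becomes such a sum, so that an identity between products
    reduces to one between scalar kernels phi. *)
Definition pairing (C : numClosedFieldType) (q N M : nat) (s : nat -> 'M[C]_q)
    (p : 'I_N -> 'M[C]_q) (r : 'I_M -> 'M[C]_q)
    (phi : nat -> nat -> {poly C}) :=
  \sum_(k < N) \sum_(l < M) p k *m moment_int s (phi k l) *m r l.

Lemma pairing_scalel (C : numClosedFieldType) (q N M : nat)
    (s : nat -> 'M[C]_q) (p : 'I_N -> 'M[C]_q) (r : 'I_M -> 'M[C]_q)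
    (c : nat -> C) (A : nat -> {poly C}) :
  (\sum_(k < N) c k *: p k) *m (\sum_(l < M) moment_int s (A l) *m r l) =
  pairing s p r (fun k l => (c k)%:P * A l).
Proof.
rewrite mulmx_suml; apply: eq_bigr => k _; rewrite mulmx_sumr.
apply: eq_bigr => l _.
by rewrite mul_polyC moment_intZ -scalemxAr !scalemxAl mulmxA.
Qed.

Lemma pairing_scaler (C : numClosedFieldType) (q N M : nat)
    (s : nat -> 'M[C]_q) (p : 'I_N -> 'M[C]_q) (r : 'I_M -> 'M[C]_q)
    (c : nat -> C) (A : nat -> {poly C}) :
  (\sum_(k < N) p k *m moment_int s (A k)) *m (\sum_(l < M) c l *: r l) =
  pairing s p r (fun k l => (c l)%:P * A k).
Proof.
rewrite mulmx_suml; apply: eq_bigr => k _; rewrite mulmx_sumr.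
apply: eq_bigr => l _.
by rewrite mul_polyC moment_intZ -!scalemxAr -scalemxAl.
Qed.

Lemma pairingZ (C : numClosedFieldType) (q N M : nat) (s : nat -> 'M[C]_q)
    (p : 'I_N -> 'M[C]_q) (r : 'I_M -> 'M[C]_q) (c : C) phi :
  c *: pairing s p r phi = pairing s p r (fun k l => c%:P * phi k l).
Proof.
rewrite scaler_sumr; apply: eq_bigr => k _; rewrite scaler_sumr.
apply: eq_bigr => l _.
by rewrite mul_polyC moment_intZ -scalemxAr -scalemxAl.
Qed.

Lemma pairingB (C : numClosedFieldType) (q N M : nat) (s : nat -> 'M[C]_q)
    (p : 'I_N -> 'M[C]_q) (r : 'I_M -> 'M[C]_q) phi psi :
  pairing s p r phi - pairing s p r psi =
  pairing s p r (fun k l => phi k l - psi k l).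
Proof.
rewrite -sumrB; apply: eq_bigr => k _; rewrite -sumrB; apply: eq_bigr => l _.
by rewrite raddfB /= mulmxBr mulmxBl.
Qed.

(** For each fixed l the sum over k already vanishes, whatever the right family is. *)
Lemma pairing_left_orth (C : numClosedFieldType) (q n M : nat)
    (s t : nat -> 'M[C]_q) (r : 'I_M -> 'M[C]_q) (h : {poly C})
    (g : nat -> {poly C}) :
  (forall k, moment_int s (h * 'X^k) = t k) ->
  (forall k, (k < n.*2)%N -> t k \is hermsymmx) ->
  ((0 < n)%N -> hankel t n.-1 \in unitmx) ->
  (forall l, (l < M)%N -> (size (g l) <= n)%N) ->
  pairing s (fun k : 'I_n.+1 => (Pcoef t k)^t*) r
    (fun k l => h * (g l * 'X^k)) = 0.
Proof.
move=> ht herm unitH le_gn; rewrite /pairing exchange_big big1 //= => l _.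
by rewrite -mulmx_suml (moment_int_left_orth ht) ?mul0mx // le_gn.
Qed.

Lemma pairing_right_orth (C : numClosedFieldType) (q n N : nat)
    (s t : nat -> 'M[C]_q) (p : 'I_N -> 'M[C]_q) (h : {poly C})
    (g : nat -> {poly C}) :
  (forall k, moment_int s (h * 'X^k) = t k) ->
  ((0 < n)%N -> hankel t n.-1 \in unitmx) ->
  (forall k, (k < N)%N -> (size (g k) <= n)%N) ->
  pairing s p (fun l : 'I_n.+1 => Pcoef t l)
    (fun k l => h * (g k * 'X^l)) = 0.
Proof.
move=> ht unitH le_gn; rewrite /pairing big1 // => k _.
under eq_bigr => l _ do rewrite -mulmxA.
by rewrite -mulmx_sumr (moment_int_right_orth ht) ?mulmx0 // le_gn.
Qed.

(** * Adjoints of P, Q_2 and Q_3 at real points *)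

Lemma size_mulS (R : nzRingType) (p r : {poly R}) (m n : nat) :
  (size p <= m.+1)%N -> (size r <= n)%N -> (size (p * r)%R <= m + n)%N.
Proof.
move=> le_p le_r; apply: leq_trans (size_polyMleq _ _) _.
by rewrite -subn1 leq_subLR add1n -addSn leq_add.
Qed.

Lemma P_adj (C : numClosedFieldType) (q : nat) (s : nat -> 'M[C]_q)
    (n : nat) (z : C) :
  z \is Num.real -> (P s n z)^t* = \sum_(k < n.+1) z ^+ k *: Pcoef s k.
Proof.
move=> z_real; rewrite P_sum adjmx_sum; apply: eq_bigr => k _.
have /CrealP zk_real : z ^+ k \is Num.real by rewrite rpredX.
by rewrite adjmxZ adjmxK zk_real.
Qed.

Lemma adjmx_moment_sum (C : numClosedFieldType) (q n N : nat)
    (s : nat -> 'M[C]_q) (p : 'I_n -> 'M[C]_q) (A : nat -> {poly C}) :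
  (forall k, (k < N)%N -> s k \is hermsymmx) ->
  (forall k, A k \is a polyOver (@Num.Def.real_num_pred C)) ->
  (forall k, (k < n)%N -> (size (A k) <= N)%N) ->
  (\sum_(k < n) (p k)^t* *m moment_int s (A k))^t* =
  \sum_(k < n) moment_int s (A k) *m p k.
Proof.
move=> hs A_real le_AN; rewrite adjmx_sum; apply: eq_bigr => k _.
by rewrite adjmxM adjmxK (moment_int_adj hs) // le_AN.
Qed.

(** Case z = 0 of the divided difference; 0^k is kept symbolic, being 1 for k = 0 and 0 otherwise.
    This avoids case splits on k and l in the kernel identities. *)
Lemma polyXn_ddiff0 (C : numClosedFieldType) (k : nat) :
  'X^k = 'X * ddiff 0 k + (0 ^+ k)%:P :> {poly C}.
Proof. by rewrite -[X in X * _]subr0 -[X in _ - X]polyC0 mul_ddiff subrK. Qed.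

(** At real points the kernel polynomials have real coefficients, so their moments are Hermitian.
    Their degree is at most n + 1, which accounts for the bound n + 2 on the moments. *)
Lemma Q2_adj (C : numClosedFieldType) (q : nat) (s : nat -> 'M[C]_q)
    (a b : C) (n : nat) (z : C) :
  a \is Num.real -> b \is Num.real -> z \is Num.real ->
  (forall k, (k < n.+2)%N -> s k \is hermsymmx) ->
  (Q2 a b s n z)^t* = \sum_(k < n.+1)
    moment_int s ((b%:P - 'X) * ('X - a%:P) * ddiff z k
                  - (z ^+ k)%:P * ('X - (a + b)%:P + z%:P))
    *m Pcoef (mom2 a b s) k.
Proof.
move=> a_real b_real z_real hs; rewrite Q2_sum.
rewrite (adjmx_moment_sum _ (A := fun k =>
   (b%:P - 'X) * ('X - a%:P) * ddiff z k
                  - (z ^+ k)%:P * ('X - (a + b)%:P + z%:P)) hs) //.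
  move=> k; rewrite rpredB ?rpredM ?rpredD ?rpredN ?polyOver_ddiff //;
  by rewrite ?polyOverC ?polyOverX ?rpredX ?rpredD.
move=> k le_kn; apply: leq_trans (size_polyD _ _) _.
have size_lin (c : C) : (size (c%:P - 'X)%R <= 2)%N.
  by rewrite -size_polyN opprB size_XsubC.
rewrite size_polyN geq_max; apply/andP; split.
  rewrite -mulrA; apply: (@leq_trans (1 + (1 + k))); last by rewrite !ltnS.
  apply: size_mulS => //; apply: size_mulS (size_ddiff z k).
  by rewrite size_XsubC.
rewrite mul_polyC (leq_trans (size_scale_leq _ _)) // addrAC -addrA.
by rewrite -polyCB -opprB polyCN size_XsubC.
Qed.

Lemma Q3_adj (C : numClosedFieldType) (q : nat) (s : nat -> 'M[C]_q)
    (b : C) (n : nat) (z : C) :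
  b \is Num.real -> z \is Num.real ->
  (forall k, (k < n.+1)%N -> s k \is hermsymmx) ->
  (Q3 b s n z)^t* = \sum_(k < n.+1)
    moment_int s ((z ^+ k)%:P - (b%:P - 'X) * ddiff z k)
    *m Pcoef (mom3 b s) k.
Proof.
move=> b_real z_real hs; rewrite Q3_sum.
rewrite (adjmx_moment_sum _
  (A := fun k => (z ^+ k)%:P - (b%:P - 'X) * ddiff z k) hs) //.
  move=> k; rewrite rpredB ?rpredM ?rpredD ?rpredN ?polyOver_ddiff //;
  by rewrite ?polyOverC ?polyOverX ?rpredX ?rpredD.
move=> k le_kn; apply: leq_trans (size_polyD _ _) _.
rewrite size_polyN geq_max (leq_trans (size_polyC_leq1 _)) //=.
apply: (@leq_trans (1 + k)) => //; apply: size_mulS (size_ddiff z k).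
by rewrite -size_polyN opprB size_XsubC.
Qed.

Lemma mom4_hermsymmx (C : numClosedFieldType) (q : nat) (s : nat -> 'M[C]_q)
    (a : C) (k : nat) :
  a \is Num.real -> s k \is hermsymmx -> s k.+1 \is hermsymmx ->
  mom4 a s k \is hermsymmx.
Proof.
move=> a_real; rewrite !hermsymmxE /mom4 => /eqP sk /eqP sk1.
have /CrealP Na_real : - a \is Num.real by rewrite rpredN.
by rewrite linearD map_mxD /= adjmxZ sk sk1 Na_real.
Qed.

(** * Splitting the scalar kernels *)

(** The right-hand side is shaped for orthogonality: the first term pairs t^k with weight 1, the
    second pairs t^l with weight (b - t)(t - a). *)
Lemma first_kernel (C : numClosedFieldType) (a b : C) (k l : nat) :
  (a ^+ k)%:P * ((b%:P - 'X) * ('X - a%:P) * ddiff a l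
                 - (a ^+ l)%:P * ('X - (a + b)%:P + a%:P))
  - (a * b)%:P * ((0 ^+ l)%:P * ddiff 0 k)
  - (0 ^+ k)%:P * ((b%:P - 'X) * ('X - a%:P) * ddiff 0 l
                 - (0 ^+ l)%:P * ('X - (a + b)%:P + 0%:P)) =
  1 * (((a * b)%:P * ddiff 0 l - a%:P * 'X^l) * 'X^k)
  - (b%:P - 'X) * ('X - a%:P) * ((ddiff a k - ddiff 0 k) * 'X^l)
  :> {poly C}.
Proof.
have [ak al] := (mul_ddiff a k, mul_ddiff a l).
have -> : (b%:P - 'X) * ('X - a%:P) * ddiff a l =
  (b%:P - 'X) * ('X^l - (a ^+ l)%:P) by rewrite -al mulrA.
have -> : (b%:P - 'X) * ('X - a%:P) * ((ddiff a k - ddiff 0 k) * 'X^l) =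
  (b%:P - 'X) * ('X^k - (a ^+ k)%:P) * 'X^l
  - (b%:P - 'X) * ('X - a%:P) * ddiff 0 k * 'X^l by rewrite -ak; ring.
(* With D^a eliminated and t^k, t^l written through D^0, the identity holds with the powers of a and
   0 as independent indeterminates. *)
rewrite !polyCM !polyCD !polyXn_ddiff0.
move: (a ^+ k)%:P (a ^+ l)%:P (0 ^+ k)%:P (0 ^+ l)%:P => α β γ δ.
rewrite polyC0; ring.
Qed.

(** Here t^k is paired with weight t - a and t^l with weight b - t. The terms are ordered as they
    appear once the minus sign in Q_4 is absorbed. *)
Lemma second_kernel (C : numClosedFieldType) (a b : C) (k l : nat) :
  b%:P * ((0 ^+ l)%:P * ((0 ^+ k)%:P + ('X - a%:P) * ddiff 0 k))
  - (b - a)%:P * ((a ^+ l)%:P * ((a ^+ k)%:P + ('X - a%:P) * ddiff a k))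
  - a%:P * ((0 ^+ k)%:P * ((0 ^+ l)%:P - (b%:P - 'X) * ddiff 0 l)) =
  ('X - a%:P) * (((b - a)%:P * ddiff a l - b%:P * ddiff 0 l) * 'X^k)
  - (b%:P - 'X) * ((a%:P * ddiff 0 k) * 'X^l)
  :> {poly C}.
Proof.
have [ak al] := (mul_ddiff a k, mul_ddiff a l).
have -> : ('X - a%:P) * (((b - a)%:P * ddiff a l - b%:P * ddiff 0 l) * 'X^k) =
  (b - a)%:P * ('X^l - (a ^+ l)%:P) * 'X^k
  - ('X - a%:P) * b%:P * ddiff 0 l * 'X^k by rewrite -al; ring.
rewrite ak !polyCB !polyXn_ddiff0.
move: (a ^+ k)%:P (a ^+ l)%:P (0 ^+ k)%:P (0 ^+ l)%:P => α β γ δ.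
ring.
Qed.

(** * The two identities *)

Lemma first_identity (C : numClosedFieldType) (q n : nat)
    (s : nat -> 'M[C]_q) (a b : C) :
  a \is Num.real -> b \is Num.real ->
  (forall k, (k < n.+1.*2)%N -> s k \is hermsymmx) ->
  hankel s n \in unitmx ->
  ((0 < n)%N -> hankel (mom2 a b s) n.-1 \in unitmx) ->
  P s n.+1 a *m (Q2 a b s n a)^t*
    - (a * b) *: (Q1 s n.+1 0 *m (P (mom2 a b s) n 0)^t*)
    - P s n.+1 0 *m (Q2 a b s n 0)^t* = 0.
Proof.
move=> a_real b_real hs unit1 unit2.
have hs' k : (k < n.+2)%N -> s k \is hermsymmx.
  move=> lt_k; apply/hs/(leq_trans lt_k).
  by rewrite doubleS !ltnS -addnn leq_addr.
rewrite !Q2_adj ?rpred0 // P_adj ?rpred0 // Q1_sum !P_sum.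
pose f : {poly C} := (b%:P - 'X) * ('X - a%:P).
rewrite (pairing_scalel s _ _ (fun k => a ^+ k)
  (fun l => f * ddiff a l - (a ^+ l)%:P * ('X - (a + b)%:P + a%:P))).
rewrite (pairing_scaler s _ _ (fun l => 0 ^+ l) (ddiff 0)).
rewrite (pairing_scalel s _ _ (fun k => 0 ^+ k)
  (fun l => f * ddiff 0 l - (0 ^+ l)%:P * ('X - (a + b)%:P + 0%:P))).
rewrite pairingZ !pairingB.
transitivity (pairing s (fun k : 'I_n.+2 => (Pcoef s k)^t*)
  (fun l : 'I_n.+1 => Pcoef (mom2 a b s) l)
  (fun k l => 1 * (((a * b)%:P * ddiff 0 l - a%:P * 'X^l) * 'X^k)
              - f * ((ddiff a k - ddiff 0 k) * 'X^l))).
  apply: eq_bigr => k _; apply: eq_bigr => l _.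
  by rewrite /f first_kernel.
rewrite -pairingB.
(* The polynomial in l has degree at most n, and P_{1,n+1} is orthogonal to all such degrees. *)
rewrite (@pairing_left_orth _ _ n.+1 _ _ _ _ _
  (fun l => (a * b)%:P * ddiff 0 l - a%:P * 'X^l)) //.
(* Here k runs up to n + 1, but the difference of quotients has size at most k - 1, hence at most
   n. *)
- rewrite (@pairing_right_orth _ _ n _ _ _ _ _
    (fun k => ddiff a k - ddiff 0 k)) ?subr0 //.
    exact: moment_int_mom2.
  move=> k le_k; apply: leq_trans (size_ddiffB _ _ _) _.
  by rewrite -subn1 leq_subLR add1n -ltnS.
- by move=> k; rewrite mul1r moment_intXn.
- move=> l le_l; apply: leq_trans (size_polyD _ _) _.
  rewrite size_polyN !mul_polyC geq_max.
  rewrite !(leq_trans (size_scale_leq _ _)) ?size_polyXn //.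
  by rewrite (leq_trans (size_ddiff _ _)) // ltnW.
Qed.

Lemma second_identity (C : numClosedFieldType) (q n : nat)
    (s : nat -> 'M[C]_q) (a b : C) :
  a \is Num.real -> b \is Num.real ->
  (forall k, (k <= n.*2)%N -> s k \is hermsymmx) ->
  ((0 < n)%N -> hankel (mom3 b s) n.-1 \in unitmx) ->
  ((0 < n)%N -> hankel (mom4 a s) n.-1 \in unitmx) ->
  (b - a) *: (Q4 a s n a *m (P (mom3 b s) n a)^t*)
    - b *: (Q4 a s n 0 *m (P (mom3 b s) n 0)^t*)
    - a *: (P (mom4 a s) n 0 *m (Q3 b s n 0)^t*) = 0.
Proof.
move=> a_real b_real hs unit3 unit4.
have hs' k : (k < n.+1)%N -> s k \is hermsymmx.
  rewrite ltnS => le_k; apply/hs/(leq_trans le_k).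
  by rewrite -addnn leq_addr.
rewrite Q3_adj ?rpred0 // !P_adj ?rpred0 // !Q4_sum P_sum !mulNmx.
rewrite (pairing_scaler s _ _ (fun l => a ^+ l)
  (fun k => (a ^+ k)%:P + ('X - a%:P) * ddiff a k)).
rewrite (pairing_scaler s _ _ (fun l => 0 ^+ l)
  (fun k => (0 ^+ k)%:P + ('X - a%:P) * ddiff 0 k)).
rewrite (pairing_scalel s _ _ (fun k => 0 ^+ k)
  (fun l => (0 ^+ l)%:P - (b%:P - 'X) * ddiff 0 l)).
(* The sign in Q_4 exchanges the roles of the first two terms, giving the order used in
   [second_kernel]. *)
rewrite !scalerN opprK [- _ + _]addrC !pairingZ !pairingB.
transitivity (pairing s (fun k : 'I_n.+1 => (Pcoef (mom4 a s) k)^t*)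
  (fun l : 'I_n.+1 => Pcoef (mom3 b s) l)
  (fun k l =>
    ('X - a%:P) * (((b - a)%:P * ddiff a l - b%:P * ddiff 0 l) * 'X^k)
    - (b%:P - 'X) * ((a%:P * ddiff 0 k) * 'X^l))).
  by apply: eq_bigr => k _; apply: eq_bigr => l _; rewrite second_kernel.
rewrite -pairingB.
rewrite (@pairing_left_orth _ _ n _ _ _ _ _
  (fun l => (b - a)%:P * ddiff a l - b%:P * ddiff 0 l)) //.
- rewrite (@pairing_right_orth _ _ n _ _ _ _ _ (fun k => a%:P * ddiff 0 k))
    ?subr0 //.
    exact: moment_int_mom3.
  move=> k le_k; rewrite mul_polyC.
  by rewrite !(leq_trans (size_scale_leq _ _)) // (leq_trans (size_ddiff _ _)).
- exact: moment_int_mom4.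
(* For k < 2n the moment s^(4)_k involves s_{k+1}, whose index is at most 2n. *)
- by move=> k lt_k; apply: mom4_hermsymmx => //; apply: hs => //; apply: ltnW.
- move=> l le_l; apply: leq_trans (size_polyD _ _) _.
  rewrite size_polyN !mul_polyC geq_max.
  by rewrite !(leq_trans (size_scale_leq _ _)) ?(leq_trans (size_ddiff _ _)).
Qed.

Theorem corollary4p9 (R : realType) (a b : R) (hab : a < b)
    (q : nat) (hq : (1 <= q)%N) (n : nat)
    (s : nat -> 'M[R[i]]_q)
    (hs : forall k : nat, (k <= 2 * n + 1)%N -> s k \is hermsymmx)
    (hpos : hausdorff_posdef a%:C b%:C s n)
    (hinv : hankel_shift s n \in unitmx)
    (hinv' : (1 <= n)%N -> hankel_shift s n.-1 \in unitmx) :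
  P s n.+1 a%:C *m (Q2 a%:C b%:C s n a%:C)^t*
    - (a%:C * b%:C) *: (Q1 s n.+1 0 *m (P (mom2 a%:C b%:C s) n 0)^t*)
    - P s n.+1 0 *m (Q2 a%:C b%:C s n 0)^t* = 0
  /\
  (b%:C - a%:C) *: (Q4 a%:C s n a%:C *m (P (mom3 b%:C s) n a%:C)^t*)
    - b%:C *: (Q4 a%:C s n 0 *m (P (mom3 b%:C s) n 0)^t*)
    - a%:C *: (P (mom4 a%:C s) n 0 *m (Q3 b%:C s n 0)^t*) = 0.
Proof.
have real_C (x : R) : x%:C \is Num.real by rewrite realE !lecR -realE num_real.
have lt_abC : a%:C < b%:C by rewrite ltcR.
have herm k : (k < n.+1.*2)%N -> s k \is hermsymmx.
  by rewrite doubleS ltnS -addn1 -mul2n; apply: hs.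
case: hpos => /posdefmx_posdef_seq pos3 /posdefmx_posdef_seq pos4.
(* [posdef_seq] counts blocks while [hankel] takes the last index, so n blocks correspond to index n
   - 1. *)
have unit_pred t : posdef_seq t n -> (0 < n)%N -> hankel t n.-1 \in unitmx.
  by case: {+}n => // m pos _; apply: posdef_seq_unit.
split.
- apply: first_identity => //.
    exact/posdef_seq_unit/(posdef_seq_mom1 lt_abC).
  exact/unit_pred/posdef_seq_mom2.
- apply: second_identity => //; last exact/unit_pred/posdef_seq_pred.
    by move=> k le_k; apply: herm; rewrite doubleS ltnS (leq_trans le_k).
  exact/unit_pred/posdef_seq_pred.
Qed.
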